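(* Let $G$ be a unicyclic graph of Type $I$ with cycle $C$, and let $v\in V(C)$ be such that the pendant tree $G\{v\}$ satisfies $v\notin Supp(G\{v\})$. Then $$\nu(G)=|Core(G\{v\})|+|Core(G-G\{v\})|+\frac{|V(\mathcal{F}_N(G\{v\}))|+|V(\mathcal{F}_N(G-G\{v\}))|}{2}.$$
   Context: All graphs are finite and simple. A unicyclic graph is a connected graph containing exactly one cycle. For a graph $H$ with adjacency matrix $A(H)$, $\mathcal{N}(H)=\{x\in\mathbb{R}^{V(H)}: A(H)x=0\}$ and the support of $H$ is $Supp(H)=\{u\in V(H): x_u\neq 0 \text{ for some } x\in\mathcal{N}(H)\}$. The core of $H$ is $Core(H)=\bigcup_{u\in Supp(H)}N(u)$, where $N(u)$ is the set of neighbors of $u$ in $H$. For a subgraph $H$ of $G$, $G-H$ is the subgraph of $G$ induced by $V(G)\setminus V(H)$. $\nu(G)$ denotes the matching number of $G$ (the size of a maximum matching). For a unicyclic graph $G$ with cycle $C$ and $v\in V(C)$, the pendant tree $G\{v\}$ of $G$ at $v$ is the induced connected subgraph of $G$ with the maximum possible number of vertices which contains $v$ and no other vertex of $C$ (it may consist of $v$ alone). Note that $G-G\{v\}$ is a tree. The vertex $v$ is called mismatched in $G\{v\}$ if some maximum matching of $G\{v\}$ does not saturate $v$ (if $G\{v\}$ consists of a single vertex, $v$ is mismatched), and matched in $G\{v\}$ otherwise. $G$ is of Type $I$ if some vertex $v\in V(C)$ is matched in $G\{v\}$; otherwise $G$ is of Type $II$. For a tree $T$, the $S$-forest $\mathcal{F}_S(T)$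 is the subgraph of $T$ induced by the closed neighborhood $N[Supp(T)]$, i.e. by $Supp(T)$ together with all neighbors of vertices of $Supp(T)$; the $N$-forest is $\mathcal{F}_N(T)=T-\mathcal{F}_S(T)$. *)

(* Defs.v *)
(* A finite simple graph is a symmetric irreflexive e : rel T on
   T : finType.  All subgraphs considered are induced, so each notion below is
   stated for the subgraph of e induced by a vertex set A : {set T}; the whole
   graph is A = [set: T]. *)
From mathcomp Require Import all_boot all_order all_algebra.
From mathcomp Require Import boolp reals.

Set Implicit Arguments.
Unset Strict Implicit.
Unset Printing Implicit Defensive.

Import GRing.Theory.
Local Open Scope ring_scope.

Section Graphs.

Variables (T : finType) (e : rel T).
Implicit Types (A : {set T}) (M : {set {set T}}) (u v : T) (c : seq T).

Definition neighbors A u : {set T} := [set w in A | e u w].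

Definition edges A : {set {set T}} :=
  [set [set p.1; p.2] | p in [set p : T * T | [&& p.1 \in A, p.2 \in A & e p.1 p.2]]].

Definition gconnected A : bool :=
  (A != set0) &&
  [forall x in A, forall y in A,
     connect [rel a b | [&& a \in A, b \in A & e a b]] x y].

(* A cycle is presented by a cyclic enumeration of its vertices; two
   enumerations present the same cycle (as a subgraph) iff they have the same
   edge set. *)
Definition is_cycle c : Prop := (3 <= size c)%N /\ ucycle e c.

Definition cycle_edges c : {set {set T}} := [set [set x; next c x] | x in c].

Definition unicyclic_with c : Prop :=
  [/\ gconnected [set: T], is_cycle c
    & forall c', is_cycle c' -> cycle_edges c' = cycle_edges c].

Definition matching A M : bool := (M \subset edges A) && trivIset M.

Definition matching_number A : nat := (\max_(M | matching A M) #|M|)%N.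

Definition maximum_matching A M : bool :=
  matching A M && (#|M| == matching_number A).

Definition mismatched A v : bool :=
  [exists M : {set {set T}}, maximum_matching A M && (v \notin cover M)].

Definition matched A v : bool := ~~ mismatched A v.

(* The default [set v] satisfies the constraint, so this is a genuine
   maximizer. *)
Definition pendant_tree c v : {set T} :=
  [arg max_(A > [set v] | [&& gconnected A, v \in A
                            & [disjoint A & [set x in c] :\ v]]) #|A|]%N.

Definition type_I c : Prop := exists2 v, v \in c & matched (pendant_tree c v) v.

Variable R : realType.

Definition adjmx A : 'M[R]_#|A| :=
  \matrix_(i, j) (e (enum_val i) (enum_val j))%:R.

Definition in_nullspace A (x : 'cV[R]_#|A|) : Prop := adjmx A *m x = 0.

Definition Supp A : {set T} :=
  [set enum_val i | i : 'I_#|A| & `[< exists2 x, in_nullspace x & x i 0 != 0 >]].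

Definition Core A : {set T} := \bigcup_(u in Supp A) neighbors A u.

Definition S_forest A : {set T} :=
  Supp A :|: \bigcup_(u in Supp A) neighbors A u.

Definition N_forest A : {set T} := A :\: S_forest A.

End Graphs.

(* Main.v *)
(** All edges leaving the pendant tree [P] at [v] are incident to [v], since any
other one would close a second cycle.  In a forest, a vertex missed by some
maximum matching lies in the support; hence [v] is matched in [P], a matching
that uses an edge leaving [P] loses an edge inside [P], and the matching number
of the graph is the sum of those of [P] and of its complement [Q].  Both are
forests, and for a forest twice the matching number is twice the size of the
core plus that of the N-forest.  The facts on forests follow by induction,
deleting either an isolated vertex or a leaf [u] with its neighbour [w]: null
vectors vanish at [w], restrict to null vectors of the rest, and extend uniquely
to [u]. *)
Require Import Defs.
From mathcomp Require Import all_boot all_order all_algebra.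
From mathcomp Require Import boolp reals.

Set Implicit Arguments.
Unset Strict Implicit.
Unset Printing Implicit Defensive.

Import GRing.Theory Num.Theory.
Local Open Scope ring_scope.

(** * Matchings in induced subgraphs: deletion of isolated vertices and leaves, cuts at a vertex *)

Section Matchings.

Variables (T : finType) (e : rel T).
Hypotheses (e_sym : symmetric e) (e_irr : irreflexive e).
Implicit Types (A B : {set T}) (M N : {set {set T}}) (u v w : T).

Lemma edgesP A (E : {set T}) :
  reflect (exists a b, [/\ a \in A, b \in A, e a b & E = [set a; b]])
          (E \in edges e A).
Proof.
apply: (iffP imsetP) => [[[a b]]|[a [b [aA bA eab ->]]]].
  by rewrite inE /= => /and3P[aA bA eab] ->; exists a, b.
by exists (a, b); rewrite // inE /= aA bA.
Qed.

Lemma edges_sub A (E : {set T}) : E \in edges e A -> E \subset A.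
Proof. by move=> /edgesP[a [b [aA bA _ ->]]]; rewrite subUset !sub1set aA. Qed.

Lemma edges_mem_sub A B (E : {set T}) :
  E \in edges e A -> E \subset B -> E \in edges e B.
Proof.
move=> /edgesP[a [b [aA bA eab ->]]]; rewrite subUset !sub1set => /andP[aB bB].
by apply/edgesP; exists a, b.
Qed.

Lemma matching_filter A B M (p : pred {set T}) :
  matching e A M -> (forall E, E \in M -> p E -> E \subset B) ->
  matching e B [set E in M | p E].
Proof.
move=> /andP[/subsetP MA tM] pB; apply/andP; split.
  by apply/subsetP=> E; rewrite inE => /andP[EM pE];
     apply: edges_mem_sub (MA _ EM) (pB _ EM pE).
by apply: trivIsetS tM; apply/subsetP=> E; rewrite inE => /andP[].
Qed.

Lemma matching_number_ge A M : matching e A M -> (#|M| <= matching_number e A)%N.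
Proof. exact: (@leq_bigmax_cond _ (matching e A) (fun M : {set {set T}} => #|M|) M). Qed.

Lemma matching0 A : matching e A set0.
Proof. by rewrite /matching sub0set; apply/trivIsetP=> E F; rewrite inE. Qed.

Lemma ex_maximum_matching A : exists M, maximum_matching e A M.
Proof.
have : (0 < #|matching e A|)%N.
  by apply/card_gt0P; exists set0; apply: matching0.
move=> /(eq_bigmax_cond (fun M : {set {set T}} => #|M|))[M mM eqM].
by exists M; apply/andP; split; last rewrite /matching_number eqM.
Qed.

Lemma trivIset_mem_eq M (E F : {set T}) v :
  trivIset M -> E \in M -> F \in M -> v \in E -> v \in F -> E = F.
Proof.
move=> tM EM FM vE vF; apply: contraTeq vF => nEF.
have := trivIsetP tM _ _ EM FM nEF.
by rewrite disjoint_subset => /subsetP/(_ _ vE); rewrite inE.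
Qed.

Lemma card_matching_at M v : trivIset M -> (#|[set E in M | v \in E]| <= 1)%N.
Proof.
move=> tM; apply/card_le1P=> E; rewrite inE => /andP[EM vE] F.
rewrite !inE; apply/andP/eqP=> [[FM vF]|->//].
exact: trivIset_mem_eq tM FM EM vF vE.
Qed.

Lemma matchingU1 A B M u w :
  B \subset A -> u \in A -> w \in A -> u \notin B -> w \notin B -> e u w ->
  matching e B M ->
  matching e A ([set u; w] |: M) /\ #|[set u; w] |: M| = #|M|.+1.
Proof.
move=> BA uA wA uB wB euw /andP[/subsetP MB tM].
have disj E : E \in M -> [disjoint [set u; w] & E].
  move=> /MB/edges_sub/subsetP EB; rewrite disjoint_subset.
  apply/subsetP=> z; rewrite !inE => /orP[]/eqP->;
  by [apply: contra uB => /EB|apply: contra wB => /EB].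
have uwM : [set u; w] \notin M.
  by apply: contra uB => /MB/edges_sub/subsetP; apply; rewrite !inE eqxx.
split; last by rewrite cardsU1 uwM.
apply/andP; split.
  apply/subsetP=> E; rewrite in_setU1 => /predU1P[->|EM].
    by apply/edgesP; exists u, w.
  exact: edges_mem_sub (MB _ EM) (subset_trans (edges_sub (MB _ EM)) BA).
apply/trivIsetP=> E F; rewrite !in_setU1 => /predU1P[->|EM] /predU1P[->|FM].
- by rewrite eqxx.
- by move=> _; apply: disj.
- by move=> _; rewrite disjoint_sym; apply: disj.
- exact: (trivIsetP tM).
Qed.

Section Isolated.

Variables (A : {set T}) (u : T).
Hypothesis uN : forall y, y \in A -> ~~ e u y.

Lemma matching_isolated M : matching e A M = matching e (A :\ u) M.
Proof.
suff eqE : edges e A = edges e (A :\ u) by rewrite /matching eqE.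
apply/setP=> E; apply/edgesP/edgesP=> -[a [b [aA bA eab ->]]]; exists a, b.
  rewrite !in_setD1 aA bA; split=> //; rewrite andbT.
    by apply: contraTneq eab => ->; apply: uN.
  by apply: contraTneq eab => ->; rewrite e_sym; apply: uN.
by move: aA bA; rewrite !in_setD1 => /andP[_ ->] /andP[_ ->].
Qed.

Lemma matching_number_isolated : matching_number e A = matching_number e (A :\ u).
Proof. by apply: eq_bigl => M; apply: matching_isolated. Qed.

Lemma mismatched_isolated v : mismatched e A v = mismatched e (A :\ u) v.
Proof.
apply: eq_existsb => M.
by rewrite /maximum_matching matching_isolated matching_number_isolated.
Qed.

End Isolated.

Section Leaf.

Variables (A : {set T}) (u w : T).
Hypotheses (uA : u \in A) (wA : w \in A) (euw : e u w).
Hypothesis uN : forall y, y \in A -> e u y -> y = w.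

Local Notation B := (A :\ u :\ w).

(** An edge avoiding [w] also avoids [u], whose only neighbour is [w]; so discarding the edge at [w]
    already leaves a matching of [B]. *)
Lemma matching_leaf_restrict M :
  matching e A M -> matching e B [set E in M | w \notin E].
Proof.
move=> mM; apply: (matching_filter mM) => E EM.
have /andP[/subsetP/(_ E EM)/edgesP[a [b [aA bA eab ->]]] _] := mM.
rewrite !inE negb_or => /andP[wa wb].
rewrite subUset !sub1set !in_setD1 aA bA (eq_sym a w) (eq_sym b w) wa wb /= !andbT.
apply/andP; split; apply: contraTneq eab => eu; rewrite eu; apply/negP=> H.
  by move: wb; rewrite (uN bA H) eqxx.
by move: wa; rewrite e_sym in H; rewrite (uN aA H) eqxx.
Qed.

Lemma card_matching_restrict M :
  trivIset M ->
  (#|M| <= #|[set E in M | w \notin E]| + (w \in cover M))%N.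
Proof.
move=> tM; have -> : #|M| = (#|[set E in M | w \notin E]| + #|[set E in M | w \in E]|)%N.
  rewrite -(cardsID [set E : {set T} | w \in E] M) addnC.
  by congr (_ + _)%N; apply: eq_card => E; rewrite !inE // andbC.
rewrite leq_add2l; case: (boolP (w \in cover M)) => [_|wM]; first exact: card_matching_at.
rewrite leqn0 cards_eq0; apply/eqP/setP=> E; rewrite !inE; apply/negP=> /andP[EM wE].
by case/negP: wM; apply/bigcupP; exists E.
Qed.

(** Passing to [B] costs at most the one edge at [w]; conversely the edge [uw] can be added to any
    matching of [B]. *)
Lemma matching_number_leaf : matching_number e A = (matching_number e B).+1.
Proof.
apply/eqP; rewrite eqn_leq; apply/andP; split.
  have [M /andP[mM /eqP<-]] := ex_maximum_matching A.
  have /andP[_ tM] := mM.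
  apply: leq_trans (card_matching_restrict tM) _; rewrite -addn1.
  by apply: leq_add; [apply/matching_number_ge/matching_leaf_restrict|case: (_ \in _)].
have [M /andP[mM /eqP<-]] := ex_maximum_matching B.
have [||||||] := @matchingU1 A B M u w _ _ _ _ _ _ mM => //.
- by rewrite !subDset setUA subsetUr.
- by rewrite !inE eqxx /= andbF.
- by rewrite !inE eqxx.
- by move=> mM' <-; apply: matching_number_ge.
Qed.

(** A maximum matching [M] missing [v] covers [w], and dropping its edge at [w] leaves a maximum
    matching of [B]. If [v] is in [B], it is still missed; if [v] is the leaf [u], the partner of
    [w] in [M] is now missed instead. *)
Lemma mismatched_leaf v : v \in A -> mismatched e A v ->
  (v \in B /\ mismatched e B v) \/
  (v = u /\ exists2 y, y \in B & e w y /\ mismatched e B y).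
Proof.
move=> vA /existsP[M /andP[/andP[mM /eqP cM] vM]]; have /andP[MA tM] := mM.
have mB := matching_leaf_restrict mM.
have cMr := card_matching_restrict tM.
have cB := matching_number_ge mB.
(* Otherwise nothing is dropped and [M] would be too large a matching of [B]. *)
have wM : w \in cover M.
  move: cMr cB; rewrite cM matching_number_leaf; case: (w \in _) => //.
  by rewrite addn0 => /leq_trans h /h; rewrite ltnn.
have maxB : maximum_matching e B [set E in M | w \notin E].
  rewrite /maximum_matching mB eqn_leq cB.
  by move: cMr; rewrite cM matching_number_leaf wM addn1 ltnS.
(* This serves two kinds of [y]: vertices missed by [M], vacuously, and the partner of [w]. *)
have covB y : (forall E, E \in M -> y \in E -> w \in E) -> mismatched e B y.
  move=> yM; apply/existsP; exists [set E in M | w \notin E]; rewrite maxB /=.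
  apply/negP=> /bigcupP[E]; rewrite inE => /andP[EM /negP wE] yE.
  by apply: wE; apply: yM yE.
have vE E : E \in M -> v \in E -> w \in E.
  by move=> EM vE; case/negP: vM; apply/bigcupP; exists E.
have vw : v != w by apply: contraNneq vM => ->.
have [vu|vu] := eqVneq v u; last first.
  by left; rewrite !in_setD1 vw vu vA; split=> //; exact: covB.
right; split=> //.
have /bigcupP[E EM wE] := wM.
have /edgesP[a [b [aA bA eab EE]]] := subsetP MA _ EM.
have nu z : z \in E -> z != u.
  by move=> zE; rewrite -vu; apply: contraNneq vM => <-; apply/bigcupP; exists E.
have nvM y : y \in E -> mismatched e B y.
  by move=> yE; apply: covB => F FM yF; rewrite -(trivIset_mem_eq tM EM FM yE yF).
have aE : a \in E by rewrite EE !inE eqxx.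
have bE : b \in E by rewrite EE !inE eqxx orbT.
move: wE; rewrite EE !inE => /orP[]/eqP we.
  exists b; last by split; [rewrite we|apply: nvM].
  rewrite !in_setD1 bA nu //= andbT.
  by apply: contraTneq eab => ->; rewrite we e_irr.
exists a; last by split; [rewrite we e_sym|apply: nvM].
rewrite !in_setD1 aA nu //= andbT.
by apply: contraTneq eab => ->; rewrite we e_irr.
Qed.

End Leaf.

(** Matching edges crossing between [P] and [Q] all contain [v], so there is at most one. If there
    is one, the edges inside [P] miss [v] and cannot form a maximum matching of [P], which offsets
    the gain. *)
Lemma matching_number_cut (P Q : {set T}) v :
  [disjoint P & Q] -> matched e P v ->
  (forall x y, x \in P -> y \in Q -> e x y -> x = v) ->
  matching_number e (P :|: Q) = (matching_number e P + matching_number e Q)%N.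
Proof.
move=> dPQ vP cut; apply/eqP; rewrite eqn_leq; apply/andP; split.
  have [M /andP[mM /eqP<-]] := ex_maximum_matching (P :|: Q).
  have /andP[MA tM] := mM.
  pose MP := [set E in M | E \subset P].
  pose MQ := [set E in M | E \subset Q].
  pose M0 := [set E in M | ~~ (E \subset P) && ~~ (E \subset Q)].
  have mP : matching e P MP by apply: matching_filter mM _.
  have mQ : matching e Q MQ by apply: matching_filter mM _.
  have cM : (#|M| <= #|MP| + #|MQ| + #|M0|)%N.
    apply: leq_trans (leq_trans (leq_card_setU _ _)
      (leq_add (leq_card_setU MP MQ) (leqnn #|M0|))).
    apply/subset_leq_card/subsetP=> E EM; rewrite !inE EM /=.
    by case: (E \subset P); case: (E \subset Q).
  have vM0 E : E \in M0 -> v \in E.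
    rewrite inE => /andP[EM].
    have /edgesP[a [b [aA bA eab ->]]] := subsetP MA _ EM.
    rewrite !subUset !sub1set; move: aA bA; rewrite !inE.
    case aP: (a \in P); case bP: (b \in P) => //= aQ bQ; rewrite ?aQ ?bQ //= => _.
      by rewrite (cut a b) ?eqxx.
    by rewrite (cut b a) ?eqxx ?orbT // e_sym.
  have [M00|[E EM0]] := set_0Vmem M0.
    apply: leq_trans cM _; rewrite M00 cards0 addn0.
    by apply: leq_add; apply: matching_number_ge.
  have cM0 : (#|M0| <= 1)%N.
    apply: leq_trans (card_matching_at v tM); apply/subset_leq_card/subsetP=> F FM0.
    by rewrite inE (vM0 _ FM0) andbT; move: FM0; rewrite inE => /andP[].
  have ltP : (#|MP| < matching_number e P)%N.
    rewrite ltn_neqAle (matching_number_ge mP) andbT.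
    apply: contra vP => cP; apply/existsP; exists MP; rewrite /maximum_matching mP cP /=.
    apply/negP=> /bigcupP[F]; rewrite inE => /andP[FM FP] vF.
    move: (EM0); rewrite inE => /and3P[EM /negP nEP _]; apply: nEP.
    by rewrite (trivIset_mem_eq tM EM FM (vM0 _ EM0) vF).
  apply: leq_trans cM _; rewrite addnAC; apply: leq_add; last exact: matching_number_ge.
  by apply: leq_trans ltP; rewrite -addn1 leq_add2l.
have [M /andP[mM /eqP<-]] := ex_maximum_matching P.
have [N /andP[mN /eqP<-]] := ex_maximum_matching Q.
have /andP[/subsetP MP tM] := mM; have /andP[/subsetP NQ tN] := mN.
have disj E F : E \in M -> F \in N -> [disjoint E & F].
  move=> /MP/edges_sub EP /NQ/edges_sub FQ.
  exact: disjointWl EP (disjointWr FQ dPQ).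
(* A common member of [M] and [N] would be disjoint from itself, hence empty. *)
have ne E : E \in M -> E != set0.
  move=> /MP/edgesP[a [b [_ _ _ ->]]]; apply/set0Pn; exists a; by rewrite !inE eqxx.
have MN0 : M :&: N = set0.
  apply/setP=> E; rewrite !inE; apply/negP=> /andP[EM EN].
  by have := disj _ _ EM EN; rewrite -setI_eq0 setIid (negPf (ne _ EM)).
have <- : #|M :|: N| = (#|M| + #|N|)%N by rewrite cardsU MN0 cards0 subn0.
apply/matching_number_ge/andP; split.
  apply/subsetP=> E; rewrite inE => /orP[/MP|/NQ] EE; apply: (edges_mem_sub EE);
  apply: subset_trans (edges_sub EE) _; by [apply: subsetUl|apply: subsetUr].
apply/trivIsetP=> E F; rewrite !inE => /orP[EM|EN] /orP[FM|FN].
- exact: (trivIsetP tM).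
- by move=> _; apply: disj.
- by move=> _; rewrite disjoint_sym; apply: disj.
- exact: (trivIsetP tN).
Qed.

End Matchings.

(** * Support, core and N-forest under vertex deletion, and induction on forests *)

Section Support.

Variables (T : finType) (e : rel T) (R : realType).
Hypotheses (e_sym : symmetric e) (e_irr : irreflexive e).
Implicit Types (A B : {set T}) (f g : T -> R) (u v w : T).

(** Null vectors are functions on all of [T] whose values outside [A] are ignored, so that one
    function can be used for [A] and for its subsets without reindexing. *)
Definition null A f := forall x, x \in A -> \sum_(y in A | e x y) f y = 0.

Lemma adjmx_mulE A f (i : 'I_#|A|) :
  (adjmx e R A *m \col_j f (enum_val j)) i 0 = \sum_(y in A | e (enum_val i) y) f y.
Proof.
rewrite mxE [RHS]big_mkcondr [RHS]big_enum_val /=.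
by apply: eq_bigr => j _; rewrite !mxE; case: (e _ _); rewrite ?mul1r ?mul0r.
Qed.

Lemma SuppP A u :
  reflect (u \in A /\ exists2 f, null A f & f u != 0) (u \in Supp e R A).
Proof.
apply: (iffP imsetP) => [[i]|[uA [f nf fu]]].
  rewrite inE => /asboolP[x nx xi] ->; split; first exact: enum_valP.
  (* The column [x] is extended by 0 outside [A]. *)
  pose f y := if insub y : {? y | y \in A} is Some z
              then x (enum_rank_in (enum_valP i) y) 0 else 0.
  have fE j : f (enum_val j) = x j 0.
    by rewrite /f insubT ?enum_valP // enum_valK_in.
  have xE : \col_j f (enum_val j) = x.
    by apply/colP=> j; rewrite mxE fE.
  exists f; last by rewrite fE.
  move=> y yA; rewrite -(enum_rankK_in (enum_valP i) yA) -adjmx_mulE xE.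
  by rewrite (_ : adjmx e R A *m x = 0) // mxE.
exists (enum_rank_in uA u); last by rewrite enum_rankK_in.
rewrite inE; apply/asboolP; exists (\col_j f (enum_val j)).
  by apply/colP=> j; rewrite adjmx_mulE nf ?mxE ?enum_valP.
by rewrite mxE enum_rankK_in.
Qed.

Lemma CoreP A w :
  reflect (w \in A /\ exists2 u, u \in Supp e R A & e u w) (w \in Core e R A).
Proof.
apply: (iffP bigcupP) => [[u uS]|[wA [u uS euw]]].
  by rewrite inE => /andP[wA euw]; split=> //; exists u.
by exists u; rewrite // inE wA.
Qed.

Lemma Supp_sub A u : u \in Supp e R A -> u \in A.
Proof. by case/SuppP. Qed.

Lemma in_N_forest A u :
  (u \in N_forest e R A) = [&& u \in A, u \notin Supp e R A & u \notin Core e R A].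
Proof. by rewrite !inE negb_or andbC. Qed.

Section Isolated.

Variables (A : {set T}) (u : T).
Hypotheses (uA : u \in A) (uN : forall y, y \in A -> ~~ e u y).

(** The equation at [u] is an empty sum, and [f u] occurs in no other equation. *)
Lemma null_isolated f : null A f <-> null (A :\ u) f.
Proof.
have E x : x \in A -> \sum_(y in A | e x y) f y = \sum_(y in A :\ u | e x y) f y.
  move=> xA; apply: eq_bigl => y; rewrite !inE; case: eqVneq => // -> /=.
  by rewrite e_sym (negPf (uN xA)) andbF.
split=> nf x; first by rewrite in_setD1 => /andP[_ xA]; rewrite -E // nf.
move=> xA; have [->|xu] := eqVneq x u.
  by rewrite big_pred0 // => y; apply/negP=> /andP[/uN/negP].
by rewrite E // nf // in_setD1 xu.
Qed.

Lemma Supp_isolated : Supp e R A = u |: Supp e R (A :\ u).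
Proof.
apply/setP=> x; rewrite in_setU1; apply/SuppP/predU1P.
  move=> [xA [f /null_isolated nf fx]]; have [->|xu] := eqVneq x u; [by left|right].
  by apply/SuppP; rewrite in_setD1 xu; split=> //; exists f.
move=> [->|/SuppP[]]; last first.
  rewrite in_setD1 => /andP[_ xA] [f nf fx]; split=> //.
  by exists f => //; apply/null_isolated.
(* The indicator of [u] vanishes on [A :\ u], hence is null there. *)
split=> //; exists (fun y => (y == u)%:R); last by rewrite eqxx oner_eq0.
apply/null_isolated => z _.
by rewrite big1 // => y; rewrite in_setD1 => /andP[/andP[/negPf-> _] _].
Qed.

Lemma Core_isolated : Core e R A = Core e R (A :\ u).
Proof.
apply/setP=> x; apply/CoreP/CoreP.
  move=> [xA [y]]; rewrite Supp_isolated in_setU1 => /predU1P[->|yS eyx].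
    by rewrite (negPf (uN xA)).
  split; last by exists y.
  rewrite in_setD1 xA andbT; apply: contraTneq eyx => ->.
  by rewrite e_sym; apply: uN; have := Supp_sub yS; rewrite in_setD1 => /andP[].
rewrite in_setD1 => -[/andP[_ xA] [y yS eyx]]; split=> //; exists y => //.
by rewrite Supp_isolated in_setU1 yS orbT.
Qed.

Lemma N_forest_isolated : N_forest e R A = N_forest e R (A :\ u).
Proof.
apply/setP=> x; rewrite !in_N_forest Core_isolated Supp_isolated in_setU1 in_setD1.
by case: (eqVneq x u) => //=; rewrite andbF.
Qed.

End Isolated.

Section Leaf.

Variables (A : {set T}) (u w : T).
Hypotheses (uA : u \in A) (wA : w \in A) (euw : e u w).
Hypothesis uN : forall y, y \in A -> e u y -> y = w.

Local Notation B := (A :\ u :\ w).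

Lemma leaf_neq : u != w.
Proof. by apply: contraTneq euw => ->; rewrite e_irr. Qed.

Lemma sum_leaf f x : x \in A ->
  \sum_(y in A | e x y) f y =
  \sum_(y in B | e x y) f y + (e x w)%:R * f w + (x == w)%:R * f u.
Proof.
move=> xA; rewrite big_mkcondr (big_setD1 u uA) (big_setD1 w) /=; last first.
  by rewrite in_setD1 wA eq_sym leaf_neq.
rewrite -big_mkcondr addrC -[X in X + _ = _]addrC; congr (_ + _ + _).
  by case: (e x w); rewrite ?mul1r ?mul0r.
have -> : e x u = (x == w).
  by rewrite e_sym; apply/idP/eqP=> [/uN->//|->].
by case: (x == w); rewrite ?mul1r ?mul0r.
Qed.

(** The equation at [u] reads [f w = 0]; the one at [w] then determines [f u]; the others do not
    involve [u]. *)
Lemma null_leaf f :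
  null A f <-> [/\ null B f, f w = 0 & f u = - \sum_(y in B | e w y) f y].
Proof.
have inB x : x \in B -> [/\ x != w, x != u & x \in A].
  by rewrite !in_setD1 => /and3P[].
split=> [nf|[nf fw fu] x xA].
  have fw : f w = 0.
    have := nf _ uA; rewrite sum_leaf // euw mul1r (negPf leaf_neq) mul0r addr0.
    rewrite big_pred0 ?add0r // => y; apply/negP=> /andP[/inB[yw _ yA] /uN yu].
    by rewrite yu ?eqxx in yw.
  split=> // [x xB|].
    have [xw xu xA] := inB _ xB.
    by have := nf _ xA; rewrite sum_leaf // fw (negPf xw) mulr0 mul0r !addr0.
  have := nf _ wA; rewrite sum_leaf // fw mulr0 eqxx mul1r addr0.
  by move=> /eqP; rewrite addrC addr_eq0 => /eqP.
rewrite sum_leaf // fw mulr0 addr0.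
have [->|xw] := eqVneq x w; first by rewrite mul1r fu subrr.
rewrite mul0r addr0; have [->|xu] := eqVneq x u; last by rewrite nf // !in_setD1 xw xu.
rewrite big_pred0 // => y; apply/negP=> /andP[/inB[yw _ yA] /uN yu].
by rewrite yu ?eqxx in yw.
Qed.

Lemma null_leaf_ext f : null B f ->
  exists2 g, null A g & {in B, g =1 f} /\ g u = - \sum_(y in B | e w y) f y.
Proof.
move=> nf; pose s := - \sum_(y in B | e w y) f y.
pose g y := if y == w then 0 else if y == u then s else f y.
have gB : {in B, g =1 f}.
  by move=> y; rewrite !in_setD1 /g => /and3P[/negPf-> /negPf->].
have sE x : \sum_(y in B | e x y) g y = \sum_(y in B | e x y) f y.
  by apply: eq_bigr => y /andP[yB _]; apply: gB.
have gu : g u = s by rewrite /g (negPf leaf_neq) eqxx.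
exists g => //; apply/null_leaf; split; last by rewrite gu sE.
  by move=> x xB; rewrite sE nf.
by rewrite /g eqxx.
Qed.

Lemma Supp_leaf_sub x : x \in B -> (x \in Supp e R A) = (x \in Supp e R B).
Proof.
move=> xB; apply/SuppP/SuppP=> -[_ [f nf fx]].
  by split=> //; exists f => //; case/null_leaf: nf.
split; first by move: xB; rewrite !in_setD1 => /and3P[].
by have [g ng [gB _]] := null_leaf_ext nf; exists g; rewrite // gB.
Qed.

Lemma Supp_leaf_neighbor : w \notin Supp e R A.
Proof. by apply/negP=> /SuppP[_ [f /null_leaf[_ -> _]]]; rewrite eqxx. Qed.

(* Without this hypothesis the values of a null vector at several neighbours of
   [w] could cancel out. *)
Hypothesis wN : exists z, forall y, y \in B -> e w y ->
  y = z \/ (forall x, x \in B -> ~~ e y x).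

(** By [null_leaf], [f u] is minus the sum of [f] over the neighbours of [w] in [B]; a supported
    neighbour must be turned into a null vector with nonzero sum. *)
Lemma Supp_leaf :
  (u \in Supp e R A) = [exists y in Supp e R B, e w y].
Proof.
apply/SuppP/exists_inP=> [[_ [f /null_leaf[nf _ fu]]]|[y yS wy]].
  rewrite fu oppr_eq0 => s0; apply/exists_inP; apply: contraR s0 => nS.
  apply/eqP; rewrite big1 // => y /andP[yB wy]; apply/eqP.
  apply: contraR nS => fy; apply/exists_inP; exists y => //.
  by apply/SuppP; split=> //; exists f.
split=> //.
suff [f nf sf] : exists2 f, null B f & \sum_(y in B | e w y) f y != 0.
  by have [g ng [_ gu]] := null_leaf_ext nf; exists g; rewrite // gu oppr_eq0.
have yB := Supp_sub yS.
(* For a neighbour [x] of [w] isolated in [B], the indicator of [x] is null on [B] and has sum 1. *)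
have isol x : x \in B -> e w x -> (forall t, t \in B -> ~~ e x t) ->
    exists2 f, null B f & \sum_(y in B | e w y) f y != 0.
  move=> xB wx xN; exists (fun t => (t == x)%:R).
    apply/(null_isolated xN) => t _.
    by rewrite big1 // => s; rewrite in_setD1 => /andP[/andP[/negPf-> _] _].
  rewrite (bigD1 x) ?xB //= eqxx big1 ?addr0 ?oner_eq0 //.
  by move=> t /andP[_ /negPf->].
have [z zP] := wN.
have [/existsP[x /and3P[xB wx /forall_inP xN]]|noisol] :=
    boolP [exists x, [&& x \in B, e w x & [forall t in B, ~~ e x t]]].
  exact: (isol x).
(* With no isolated neighbour, [wN] leaves at most one neighbour of [w] in [B], so the sum has a
   single term. *)
have eqz x : x \in B -> e w x -> x = z.
  move=> xB wx; case: (zP _ xB wx) => // xN; case/negP: noisol.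
  by apply/existsP; exists x; rewrite xB wx; apply/forall_inP.
have /SuppP[_ [f nf fy]] := yS; exists f => //.
rewrite (bigD1 y) ?yB //= big1 ?addr0 // => t /andP[/andP[tB wt]].
by rewrite (eqz y) // (eqz t) // eqxx.
Qed.

(** A supported neighbour of [x] lies in [B]: it is not [w], which is unsupported, nor [u], which is
    adjacent only to [w]. *)
Lemma Core_leaf_sub x : x \in B -> (x \in Core e R A) = (x \in Core e R B).
Proof.
move=> xB; have := xB; rewrite !in_setD1 => /and3P[xw xu xA].
apply/CoreP/CoreP=> -[_ [y yS eyx]]; split=> //; exists y => //.
  have yA := Supp_sub yS.
  rewrite -Supp_leaf_sub // !in_setD1 yA andbT; apply/andP; split.
    by apply: contraTneq yS => ->; apply: Supp_leaf_neighbor.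
  by apply: contraTneq eyx => ->; apply: contra xw => /uN->.
by rewrite Supp_leaf_sub // (Supp_sub yS).
Qed.

Lemma Core_leaf : u \notin Core e R A.
Proof.
apply/negP=> /CoreP[_ [y yS]]; rewrite e_sym => /uN yw.
by move: (yS) Supp_leaf_neighbor; rewrite (yw (Supp_sub yS)) => ->.
Qed.

Lemma Core_leaf_neighbor : (w \in Core e R A) = (u \in Supp e R A).
Proof.
apply/CoreP/idP=> [[_ [y yS eyw]]|uS]; last by split=> //; exists u.
have [<-//|yu] := eqVneq y u.
rewrite Supp_leaf; apply/exists_inP; exists y; last by rewrite e_sym.
have yw : y != w by apply: contraTneq eyw => ->; rewrite e_irr.
by rewrite -Supp_leaf_sub // !in_setD1 yw yu (Supp_sub yS).
Qed.

Lemma card_leaf (D : {set T}) :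
  D \subset A -> #|D| = ((u \in D) + (w \in D) + #|D :&: B|)%N.
Proof.
move=> DA; rewrite (cardsD1 u D) (cardsD1 w (D :\ u)) in_setD1 eq_sym leaf_neq addnA.
congr (_ + _)%N; apply: eq_card => x; rewrite !in_setI !in_setD1.
by case: (x =P u); case: (x =P w); rewrite ?andbF //= => _ _;
   apply/idP/andP=> [xD|[]//]; split=> //; apply: (subsetP DA).
Qed.

(** If [u] is supported, [w] is in the core and neither vertex is in the N-forest; otherwise both
    are in the N-forest and neither is in the core. Either way they contribute 2, and nothing
    changes inside [B]. *)
Lemma card_Core_N_forest_leaf :
  (2 * #|Core e R A| + #|N_forest e R A| =
   (2 * #|Core e R B| + #|N_forest e R B|).+2)%N.
Proof.
have CA : Core e R A \subset A by apply/subsetP=> x /CoreP[].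
have NA : N_forest e R A \subset A by apply: subsetDl.
have CB : Core e R A :&: B = Core e R B.
  apply/setP=> x; rewrite in_setI.
  by apply/andP/idP=> [[xC xB]|xC]; last have [xB _] := CoreP _ _ xC;
     rewrite ?Core_leaf_sub // in xC *.
have NB : N_forest e R A :&: B = N_forest e R B.
  apply/setP=> x; rewrite in_setI !in_N_forest.
  have [xB|] := boolP (x \in B); last by rewrite andbF.
  rewrite Core_leaf_sub // Supp_leaf_sub //.
  by move: xB; rewrite !in_setD1 => /and3P[_ _ ->]; rewrite andbT.
rewrite (card_leaf CA) (card_leaf NA) CB NB !in_N_forest uA wA.
rewrite (negPf Core_leaf) Supp_leaf_neighbor Core_leaf_neighbor.
by case: (u \in _); rewrite /= ?add0n ?addn0 ?mulnDr ?addnS ?addSn ?add0n ?add1n.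
Qed.

End Leaf.

(** Acyclicity in hereditary form: every nonempty induced subgraph has a vertex of degree at most
    one. This is what the induction consumes. *)
Definition forest A := forall B, B \subset A -> B != set0 ->
  exists2 u, u \in B & (#|neighbors e B u| <= 1)%N.

Lemma forestS A B : B \subset A -> forest A -> forest B.
Proof. by move=> BA fA D DB; apply: fA; apply: subset_trans DB BA. Qed.

Lemma neighbors_le1 A u w :
  (#|neighbors e A u| <= 1)%N -> w \in A -> e u w ->
  forall y, y \in A -> e u y -> y = w.
Proof.
move=> /card_le1_eqP h wA uw y yA uy.
by apply: h; rewrite inE ?yA ?wA.
Qed.

(* [w] is a leaf of what remains of [A] after deleting all its leaves. *)
Lemma forest_leaf A : forest A -> A != set0 ->
  (exists2 u, u \in A & forall y, y \in A -> ~~ e u y) \/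
  (exists u w, [/\ u \in A, w \in A, e u w,
     forall y, y \in A -> e u y -> y = w &
     exists z, forall y, y \in A :\ u :\ w -> e w y ->
       y = z \/ (forall x, x \in A :\ u :\ w -> ~~ e y x)]).
Proof.
move=> fA A0.
pose L := [set u in A | (#|neighbors e A u| <= 1)%N].
have LA : L \subset A by apply/subsetP=> x; rewrite inE => /andP[].
have [|noiso] := boolP [exists u in A, [forall y in A, ~~ e u y]].
  by move=> /exists_inP[u uA /forall_inP uN]; left; exists u.
right.
have nb u : u \in A -> exists2 w, w \in A & e u w.
  move=> uA; move: noiso; rewrite negb_exists_in => /forall_inP/(_ u uA).
  by rewrite negb_forall_in => /exists_inP[w wA]; rewrite negbK; exists w.
(* A leaf adjacent to [w] becomes isolated once [w] is deleted. *)
have isoL w y : w \in A -> e w y -> y \in L -> forall x, x \in A :\ w -> ~~ e y x.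
  rewrite inE => wA wy /andP[yA y1] x; rewrite in_setD1 => /andP[xw xA].
  apply: contra xw => yx; apply/eqP; apply: (neighbors_le1 y1) yx => //.
  by rewrite e_sym.
have inW u w x : x \in A :\ u :\ w -> x \in A :\ w.
  by rewrite !in_setD1 => /and3P[-> _ ->].
have inA u w x : x \in A :\ u :\ w -> x \in A.
  by move=> /inW; rewrite in_setD1 => /andP[].
have [AL0|[w0 w0AL]] := set_0Vmem (A :\: L).
  have AL : {subset A <= L} by apply/subsetP; rewrite -setD_eq0 AL0.
  have /set0Pn[u uA] := A0; have [w wA uw] := nb _ uA.
  exists u, w; split=> //.
    by have := AL _ uA; rewrite inE => /andP[_ u1]; apply: neighbors_le1 uw.
  (* All neighbours of [w] left in [B] are isolated, so the witness is arbitrary. *)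
  exists u => y yB wy; right=> x xB.
  by apply: (isoL w) (inW _ _ _ xB) => //; apply/AL/(inA _ _ _ yB).
(* This [w] has at most one neighbour outside [L] but, not being in [L], at least two in [A]; so
   some neighbour [u] is a leaf. *)
have [||w wAL w1] := fA (A :\: L); first exact: subsetDl.
  by apply/set0Pn; exists w0.
have := wAL; rewrite !inE => /andP[]; rewrite negb_and => wL wA.
move: wL; rewrite wA /= -ltnNge => w2.
have [u uA [uL wu]] : exists2 u, u \in A & u \in L /\ e w u.
  have : ~~ (neighbors e A w \subset neighbors e (A :\: L) w).
    by apply: contraL w2 => /subset_leq_card h; rewrite -leqNgt; apply: leq_trans h w1.
  move=> /subsetPn[u]; rewrite !inE => /andP[uA wu]; rewrite uA wu !andbT negbK.
  by move=> u1; exists u; rewrite // !inE uA.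
exists u, w; split=> //; first by rewrite e_sym.
  have := uL; rewrite inE => /andP[_ u1]; apply: neighbors_le1 => //.
  by rewrite e_sym.
have isoB y : y \in L -> e w y -> forall x, x \in A :\ u :\ w -> ~~ e y x.
  by move=> yL wy x xB; apply: (isoL w) (inW _ _ _ xB).
have [N0|[z]] := set_0Vmem (neighbors e (A :\: L) w).
  exists w => y yB wy; right; apply: isoB => //.
  apply: contraT => yL; have := in_set0 y; rewrite -N0 /neighbors 2!inE yL wy.
  by rewrite (inA _ _ _ yB).
(* Here [z] is the only neighbour of [w] outside [L]. *)
rewrite inE => /andP[zAL wz]; exists z => y yB wy.
have [yL|yL] := boolP (y \in L); [right; exact: isoB|left].
by apply: (neighbors_le1 w1) => //; rewrite in_setD yL (inA _ _ _ yB).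
Qed.

Lemma forest_ind (p : {set T} -> Prop) :
  p set0 ->
  (forall A u, u \in A -> (forall y, y \in A -> ~~ e u y) -> p (A :\ u) -> p A) ->
  (forall A u w, u \in A -> w \in A -> e u w ->
     (forall y, y \in A -> e u y -> y = w) ->
     (exists z, forall y, y \in A :\ u :\ w -> e w y ->
       y = z \/ (forall x, x \in A :\ u :\ w -> ~~ e y x)) ->
     p (A :\ u :\ w) -> p A) ->
  forall A, forest A -> p A.
Proof.
move=> p0 piso pleaf A; have [n] := ubnP #|A|; elim: n A => // n IH A leA fA.
have [->//|A0] := eqVneq A set0.
have IHs B : B \proper A -> p B.
  move=> BA; apply: IH; last exact: forestS (proper_sub BA) fA.
  by apply: leq_trans (proper_card BA) _; rewrite -ltnS.
case: (forest_leaf fA A0) => [[u uA uN]|[u [w [uA wA uw uN wN]]]].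
  by apply: (piso A u) => //; apply: IHs; apply: properD1.
apply: (pleaf A u w) => //; apply: IHs.
by apply: sub_proper_trans (properD1 uA); apply: subD1set.
Qed.

(** Deleting an isolated vertex changes neither side; deleting a leaf with its neighbour lowers both
    by 2. Doubling keeps the identity in [nat]. *)
Lemma matching_number_forest A : forest A ->
  (2 * matching_number e A = 2 * #|Core e R A| + #|N_forest e R A|)%N.
Proof.
move: A; apply: forest_ind => [|A u uA uN IH|A u w uA wA uw uN wN IH].
- have [M /andP[/andP[/subsetP M0 _] /eqP<-]] := ex_maximum_matching e set0.
  have -> : M = set0.
    by apply/setP=> E; rewrite inE; apply/negP=> /M0/edgesP[a [b []]]; rewrite inE.
  have -> : Core e R set0 = set0.
    by apply/setP=> x; rewrite inE; apply/negP=> /CoreP[]; rewrite inE.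
  by rewrite /N_forest set0D !cards0.
- rewrite (matching_number_isolated e_sym uN) IH.
  by rewrite (Core_isolated uA uN) (N_forest_isolated uA uN).
- rewrite (matching_number_leaf e_sym uA wA uw uN) mulnS IH.
  by rewrite (card_Core_N_forest_leaf uA wA uw uN wN).
Qed.

(** When [v] is the deleted leaf, [mismatched_leaf] yields a mismatched neighbour of [w], supported
    by induction, and [Supp_leaf] carries this back to [v]. *)
Lemma mismatched_Supp A : forest A ->
  forall v, v \in A -> mismatched e A v -> v \in Supp e R A.
Proof.
move: A; apply: forest_ind => [|A u uA uN IH|A u w uA wA uw uN wN IH] v vA.
- by rewrite inE in vA.
- rewrite (mismatched_isolated e_sym uN) (Supp_isolated uA uN) in_setU1.
  by case: eqVneq => //= vu; apply: IH; rewrite in_setD1 vu.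
- move=> /(mismatched_leaf e_sym e_irr uA wA uw uN vA)[[vB mB]|[-> [y yB [wy my]]]].
    by rewrite (Supp_leaf_sub uA wA uw uN vB) IH.
  rewrite (Supp_leaf uA wA uw uN wN); apply/exists_inP; exists y => //.
  exact: IH.
Qed.

End Support.

(** * Cycles, and forests as graphs without cycles *)

Section Cycles.

Variables (T : finType) (e : rel T).
Hypotheses (e_sym : symmetric e) (e_irr : irreflexive e).
Implicit Types (A B : {set T}) (c p : seq T) (u v w x y : T).

Lemma cover_cycle_edges c : cover (cycle_edges c) = [set x in c].
Proof.
apply/setP=> x; rewrite inE; apply/bigcupP/idP=> [[_ /imsetP[y yc ->]]|xc].
  by rewrite !inE => /orP[]/eqP->; rewrite ?mem_next.
by exists [set x; next c x]; [apply/imsetP; exists x|rewrite !inE eqxx].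
Qed.

(** A simple path from [y] to [x] that avoids the edge [xy] closes up with it. *)
Lemma edge_in_cycle x y : e x y ->
  connect [rel a b | e a b && ([set a; b] != [set x; y])] y x ->
  exists2 c, is_cycle e c & [set x; y] \in cycle_edges c.
Proof.
move=> exy /connectP[p0 pp0 xl]; case/shortenP: pp0 xl => p pp up _ xl.
have pe : path e y p by apply: sub_path pp => a b /= /andP[].
exists (y :: p).
  split; last by rewrite /ucycle /= rcons_path pe -xl exy -/(uniq (y :: p)) up.
  (* At least three vertices: an empty path would make [xy] a loop, and a one-step path would use
     the excluded edge. *)
  case: p xl pp {up pe} => [xy|a [|b p]] //=; first by rewrite xy e_irr in exy.
  by move=> ->; rewrite setUC eqxx andbF.
have xp : x \in y :: p by rewrite xl mem_last.
apply/imsetP; exists x => //; congr [set _; _].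
(* Since [x] comes last, its successor is the head [y], the default value of [nth]. *)
by rewrite next_nth xp xl index_last // nth_default.
Qed.

(** The path is grown at its head [x]; once stuck, all neighbours of [x] lie on it, and one other
    than the next vertex closes a cycle. *)
Lemma mindeg2_path B x p :
  (forall u, u \in B -> (1 < #|neighbors e B u|)%N) ->
  path e x p -> uniq (x :: p) -> {subset x :: p <= B} ->
  exists2 c, is_cycle e c & {subset c <= B}.
Proof.
move=> deg; have [n] := ubnP (#|B| - size p); elim: n x p => // n IH x p le_n xp up sB.
have le_p : (size p < #|B|)%N.
  have /card_uniqP sz := up; rewrite -[(_ < _)%N]/(size (x :: p) <= _)%N -sz.
  exact/subset_leq_card/subsetP.
have xB : x \in B by apply: sB; rewrite inE eqxx.
have [/exists_inP[y yB /andP[xy yp]]|noext] :=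
    boolP [exists y in B, e x y && (y \notin x :: p)].
  apply: (IH y (x :: p)).
  - apply: leq_trans (_ : (#|B| - size p <= n)%N); last by rewrite -ltnS.
    by rewrite ltn_sub2l.
  - by rewrite /= e_sym xy.
  - by rewrite cons_uniq yp.
  - by move=> z; rewrite inE => /predU1P[->|/sB].
have inp y : y \in B -> e x y -> y \in p.
  move=> yB xy; move: noext; rewrite negb_exists_in => /forall_inP/(_ y yB).
  by rewrite xy negbK inE => /predU1P[yx|//]; rewrite yx e_irr in xy.
have [a [p' pE]] : exists a p', p = a :: p'.
  have /card_gt0P[y] : (0 < #|neighbors e B x|)%N by apply: ltnW (deg _ xB).
  by rewrite inE => /andP[yB /(inp _ yB)]; case: (p) => // a p' _; exists a, p'.
have [z zB [xz za]] : exists2 z, z \in B & e x z /\ z != a.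
  have /card_gt1P[y [z [+ + yz]]] := deg _ xB; rewrite !inE => /andP[yB xy] /andP[zB xz].
  have [ya|ya] := eqVneq y a; last by exists y.
  by exists z => //; split=> //; rewrite -ya eq_sym.
have zp : z \in p' by have := inp _ zB xz; rewrite pE inE (negPf za).
move: zp pE => /splitPr[p1 p2] pE.
have pE' : x :: p = (x :: a :: rcons p1 z) ++ p2 by rewrite pE /= cat_rcons.
exists (x :: a :: rcons p1 z); last first.
  by move=> y yc; apply: sB; rewrite pE' mem_cat yc.
split; first by rewrite /= size_rcons.
apply/andP; split; last by move: up; rewrite pE' cat_uniq => /andP[].
move: xp; rewrite pE -cat_rcons -cat_cons cat_path => /andP[xc _].
by rewrite /cycle rcons_path xc /= last_rcons e_sym xz.
Qed.

(** If all degrees in [B] were at least two, a path grown from a single vertex would give a cycle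
    inside [B]. *)
Lemma acyclic_forest A :
  (forall c, is_cycle e c -> ~ {subset c <= A}) -> forest e A.
Proof.
move=> acyc B BA /set0Pn[x xB].
have [/exists_inP[u uB u1]|no] := boolP [exists u in B, (#|neighbors e B u| <= 1)%N].
  by exists u.
case: (@mindeg2_path B x [::]) => //.
- move=> u uB; move: no; rewrite negb_exists_in => /forall_inP/(_ u uB).
  by rewrite -ltnNge.
- by move=> y; rewrite inE => /eqP->.
by move=> c cc cB; case: (acyc c cc) => y /cB /(subsetP BA).
Qed.

(** * The pendant tree and its complement in a unicyclic graph *)

Section Unicyclic.

Variables (c : seq T) (v : T).
Hypotheses (Gc : unicyclic_with e c) (vc : v \in c).

Local Notation P := (pendant_tree e c v).

(** Every cycle has the edges, hence the vertices, of [c], and so passes through [x]. *)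
Lemma unicyclic_forest A x : x \in c -> x \notin A -> forest e A.
Proof.
move=> xc xA; apply: acyclic_forest => c' cc' sA; case/negP: xA; apply: sA.
have [_ _ /(_ _ cc') E] := Gc.
have : x \in cover (cycle_edges c') by rewrite E cover_cycle_edges inE.
by rewrite cover_cycle_edges inE.
Qed.

Lemma gconnected1 x : gconnected e [set x].
Proof.
apply/andP; split; first by apply/set0Pn; exists x; rewrite inE.
apply/forall_inP=> a; rewrite inE => /eqP->; apply/forall_inP=> b; rewrite inE => /eqP->.
exact: connect0.
Qed.

Lemma gconnectedU1 A x y : gconnected e A -> x \in A -> e x y -> gconnected e (y |: A).
Proof.
move=> /andP[_ /forall_inP cA] xA exy; apply/andP; split.
  by apply/set0Pn; exists y; rewrite !inE eqxx.
set r := [rel a b | _].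
have rsym : connect_sym r.
  by apply: sym_connect_sym => a b; rewrite /= e_sym andbCA.
have toy a : a \in y |: A -> connect r y a.
  rewrite in_setU1 => /predU1P[->|aA]; first exact: connect0.
  apply: (@connect_trans _ _ x).
    by apply: connect1; rewrite /= e_sym exy !inE eqxx xA orbT.
  have /forall_inP/(_ _ aA) := cA _ xA; apply: connect_sub => s t /= /and3P[sA tA est].
  by apply: connect1; rewrite /= !inE sA tA est !orbT.
apply/forall_inP=> a aA; apply/forall_inP=> b bA.
by apply: (@connect_trans _ _ y); [rewrite rsym|]; apply: toy.
Qed.

(** The last clause is maximality: a neighbour [y] off the cycle could be added. *)
Lemma pendant_treeP :
  [/\ gconnected e P, v \in P, (forall x, x \in P -> x \in c -> x = v) &
      forall x y, x \in P -> y \notin P -> e x y -> y \in c].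
Proof.
rewrite /pendant_tree; case: arg_maxnP => [|A /and3P[cA vA dA] maxA].
  (* The default [[set v]] must itself be admissible for the maximum. *)
  rewrite gconnected1 !inE eqxx /= -setI_eq0; apply/eqP/setP=> x; rewrite !inE.
  by case: eqVneq.
split=> // [x xA xc|x y xA yA exy].
  apply/eqP; apply: contraTT dA => xv; apply/pred0Pn; exists x.
  by rewrite /= xA !inE xv.
apply: contraNT yA => yc.
have : [&& gconnected e (y |: A), v \in y |: A & [disjoint y |: A & [set x in c] :\ v]].
  rewrite (gconnectedU1 cA xA exy) in_setU1 vA orbT /=.
  rewrite disjoints_subset subUset sub1set -disjoints_subset dA andbT.
  by rewrite !inE (negPf yc) andbF.
by move=> /maxA; rewrite cardsU1; case: (y \in A); rewrite // add1n /= ltnn.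
Qed.

(* Otherwise the edge, the path from [x] to [v] in the pendant tree and an arc
   of the cycle would form a second cycle. *)
Lemma pendant_tree_cut x y : x \in P -> y \notin P -> e x y -> x = v.
Proof.
have [cP vP Pc yc] := pendant_treeP => xP yP exy; apply/eqP; apply: contraT => xv.
have xc : x \notin c by apply: contra xv => /(Pc _ xP)->.
pose r := [rel a b | e a b && ([set a; b] != [set x; y])].
have [_ [_ /andP[cyc _]] uniqc] := Gc.
(* An arc of [c] joins [y] to [v]; it avoids the edge [xy] because [x] is not on [c]. *)
have yv : connect r y v.
  have cr : cycle r c.
    apply: (sub_in_cycle (P := [in c])) cyc; last exact/allP.
    move=> a b ac bc /= ->; apply: contra xc => /eqP E.
    have : x \in [set a; b] by rewrite E !inE eqxx.
    by rewrite !inE => /orP[]/eqP->.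
  exact: (connect_cycle cr) (yc _ _ xP yP exy) vc.
(* A path inside [P] avoids the edge [xy] because [y] is not in [P]. *)
have vx : connect r v x.
  have /andP[_ /forall_inP/(_ _ vP)/forall_inP/(_ _ xP)] := cP.
  apply: connect_sub => a b /= /and3P[aP bP eab]; apply: connect1 => /=.
  rewrite eab; apply: contra yP => /eqP E.
  have : y \in [set a; b] by rewrite E !inE eqxx orbT.
  by rewrite !inE => /orP[]/eqP->.
have [c' cc' xyc'] := edge_in_cycle exy (connect_trans yv vx).
case/negP: xc; have : x \in cover (cycle_edges c).
  by rewrite -(uniqc _ cc'); apply/bigcupP; exists [set x; y]; rewrite // !inE eqxx.
by rewrite cover_cycle_edges inE.
Qed.

(** The pendant tree meets [c] only in [v], so it misses some other vertex of [c]. *)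
Lemma pendant_tree_forest : forest e P.
Proof.
have [_ _ Pc _] := pendant_treeP.
have [_ [c3 /andP[_ uc]] _] := Gc.
have [x xc xv] : exists2 x, x \in c & x != v.
  case: (c) c3 uc => [|a [|b s]] //= _ /andP[ab _].
  have [av|] := eqVneq a v; last by exists a; rewrite // inE eqxx.
  exists b; first by rewrite !inE eqxx orbT.
  by rewrite -av eq_sym; move: ab; rewrite inE negb_or => /andP[].
by apply: (unicyclic_forest xc); apply: contra xv => /Pc->.
Qed.

Lemma pendant_tree_compl_forest : forest e ([set: T] :\: P).
Proof.
have [_ vP _ _] := pendant_treeP.
by apply: (unicyclic_forest vc); rewrite inE vP.
Qed.

End Unicyclic.

End Cycles.

Theorem theorem5p3 (R : realType) (T : finType) (e : rel T)
    (e_sym : symmetric e) (e_irr : irreflexive e)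
    (c : seq T) (Gc : unicyclic_with e c) (GI : type_I e c)
    (v : T) (vc : v \in c)
    (vS : v \notin Supp e R (pendant_tree e c v)) :
  let P := pendant_tree e c v in
  let Q := [set: T] :\: P in
  (matching_number e [set: T])%:R =
    #|Core e R P|%:R + #|Core e R Q|%:R
    + (#|N_forest e R P|%:R + #|N_forest e R Q|%:R) / 2 :> rat.
Proof.
move=> P Q; have [_ vP _ _] := pendant_treeP e_sym c v.
have fP : forest e P := pendant_tree_forest e_sym e_irr (v := v) Gc.
have fQ : forest e Q := pendant_tree_compl_forest e_sym e_irr Gc vc.
(* Contrapositive of [mismatched_Supp]. *)
have mv : matched e P v.
  by apply: contra vS; apply: (mismatched_Supp _ e_sym e_irr fP).
have PQ : [disjoint P & Q] by rewrite -setI_eq0 setIDA setIT setDv.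
have cut x y : x \in P -> y \in Q -> e x y -> x = v.
  rewrite !inE andbT => xP yP; exact: (pendant_tree_cut e_sym e_irr Gc vc xP yP).
have TE : [set: T] = P :|: Q by rewrite /Q setDE setTI setUCr.
rewrite TE (matching_number_cut e_sym PQ mv cut) natrD.
(* The doubled identity in [nat] is cast to [rat], where 2 can be cancelled. *)
have half (A : {set T}) : forest e A ->
    (matching_number e A)%:R = #|Core e R A|%:R + #|N_forest e R A|%:R / 2 :> rat.
  move=> /(matching_number_forest R e_sym e_irr) /(congr1 (fun n => n%:R : rat)).
  rewrite natrD !natrM => E; apply: (@mulfI _ 2) => //.
  by rewrite E mulrDr [2 * (_ / 2)]mulrC divfK.
by rewrite (half _ fP) (half _ fQ) mulrDl addrACA.
Qed.
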